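(* Let $X$ be a uniformly convex and uniformly smooth Banach space and let $A:X\to 2^X$ be an m-accretive operator with $A^{-1}0\neq\emptyset$, and let $p\in A^{-1}0$. Suppose that there exists a weak modulus for the convergence condition $\Omega:\mathbb{N}\times\mathbb{N}^{\mathbb{N}}\to\mathbb{N}^{\mathbb{N}}$ for $A$. Let $\mathcal{S}=\{S(t)\mid t\geq 0\}$ be the semigroup generated by $A$ via the exponential formula. Let $x\in\overline{\mathrm{dom}A}$ and let $f:\mathbb{N}\to\mathbb{N}$ be nondecreasing and such that $$\forall n\in\mathbb{N}\ \exists u_n,v_n\in X\left(v_n\in Au_n\land \|u_n\|,\|v_n\|\leq f(n)\land \|u_{n}-x\|\leq\frac{1}{n+1}\right).$$ Then $$\forall k\in\mathbb{N}\ \forall s,s'\geq\chi_k(\Omega(K_k,\mathrm{id})(6k+5))\left(\|S(s)x-S(s')x\|\leq\frac{1}{k+1} \right),$$ where $$\chi_k(j)=\left\lceil\frac{1}{2}b_k^2+1\right\rceil(j+1)$$ for any $b_k,K_k\in\mathbb{N}$ with $b_k\geq\|x-Px\|+\|x\|+f(3k+2)$ and $K_k\geq f(3k+2)+2\|p\|$.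
   Context: $\mathbb{N}=\{0,1,2,\dots\}$ and $\mathrm{id}:\mathbb{N}\to\mathbb{N}$ is the identity. $X$ is a real Banach space. Since $X$ is uniformly smooth, its normalized duality map $J(x)=\{f\in X^*\mid f(x)=\|x\|^2,\ \|f\|=\|x\|\}$ is single-valued; it is identified with a map $J:X\to X^*$ and $\langle y,J(x)\rangle$ denotes $J(x)(y)$. A set-valued operator $A:X\to 2^X$ is identified with its graph $\{(x,y)\mid y\in Ax\}$; $\mathrm{dom}A=\{x\mid Ax\neq\emptyset\}$ and $A^{-1}0=\{x\mid 0\in Ax\}$. $A$ is accretive if $\langle y_1-y_2,J(x_1-x_2)\rangle\geq 0$ for all $(x_1,y_1),(x_2,y_2)\in A$, and m-accretive if in addition $\mathrm{ran}(\mathrm{Id}+\gamma A)=X$ for all $\gamma>0$. If $A$ is m-accretive with $A^{-1}0\neq\emptyset$, then $A^{-1}0$ is closed and convex and $P$ denotes the (single-valued) nearest point projection of $X$ onto $A^{-1}0$. The semigroup generated by $A$ via the exponential formula is given by $S(t)x=\lim_{n\to\infty}(\mathrm{Id}+\frac{t}{n}A)^{-n}x$ for $x\in\overline{\mathrm{dom}A}$, $t\geq 0$ (the limit exists by the Crandall–Liggett theorem, and the $S(t)$ form a semigroup of nonexpansive maps on $\overline{\mathrm{dom}A}$, continuous in $t$). For a sequence $(a_n)$ of non-negative reals, $\varphi:\mathbb{N}\to\mathbb{N}$ is a rate of convergence (towards zero) if $\forall k\,\forall n\geq\varphi(k)\,(a_n\leq\frac{1}{k+1})$, and a rate of approximate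 zeros if $\forall k\,\exists n\leq\varphi(k)\,(a_n\leq\frac1{k+1})$. A weak modulus for the convergence condition for $A$ is a functional $\Omega:\mathbb{N}\times\mathbb{N}^{\mathbb{N}}\to\mathbb{N}^{\mathbb{N}}$ such that for any sequences $(x_n),(y_n)\subseteq X$, any $K\in\mathbb{N}$ and any $\varphi:\mathbb{N}\to\mathbb{N}$: if $y_n\in Ax_n$ and $\|x_n\|,\|y_n\|\leq K$ for all $n$, and $\varphi$ is a rate of convergence for $|\langle y_n,J(x_n-Px_n)\rangle|$, then $\Omega(K,\varphi)$ is a rate of approximate zeros for $\|x_n-Px_n\|$. *)

(* Defs.v *)
From HB Require Import structures.
From mathcomp Require Import all_boot all_order all_algebra.
From mathcomp Require Import all_classical all_reals all_analysis.

Set Implicit Arguments.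
Unset Strict Implicit.
Unset Printing Implicit Defensive.

Import Order.TTheory GRing.Theory Num.Theory.
Import numFieldNormedType.Exports.

Local Open Scope classical_set_scope.
Local Open Scope ring_scope.

Section Geometry.
Context {R : realType} (X : completeNormedModType R).

Definition uniformly_convex : Prop :=
  forall e : R, 0 < e -> e <= 2 -> exists2 d : R, 0 < d &
    forall x y : X, `|x| <= 1 -> `|y| <= 1 -> e <= `|x - y| ->
      `|2^-1 *: (x + y)| <= 1 - d.

(* rho(t) / t --> 0 as t --> 0+ with the modulus of smoothness rho unfolded *)
Definition uniformly_smooth : Prop :=
  forall e : R, 0 < e -> exists2 d : R, 0 < d &
    forall x y : X, `|x| = 1 -> `|y| <= d ->
      `|x + y| + `|x - y| <= 2 + e * `|y|.

End Geometry.

Section Duality.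
Context {R : realType} {X : completeNormedModType R}.

Definition dual_norm (f : X -> R) : R :=
  sup [set `|f x| | x in [set x : X | `|x| <= 1]].

Definition duality_set (x : X) : set {linear X -> R^o} :=
  [set f : {linear X -> R^o} |
    continuous f /\ f x = `|x| ^+ 2 /\ dual_norm f = `|x|].

(* The element of [duality_set x], which is a singleton when X is uniformly
   smooth; <y, J x> is [J x y]. *)
Definition J (x : X) : {linear X -> R^o} := xget (\0 : {linear X -> R^o}) (duality_set x).

End Duality.

Section Operators.
Context {R : realType} {X : completeNormedModType R}.
Implicit Types (A : X -> set X) (g t : R).

Definition dom A : set X := [set x | A x !=set0].

Definition ran A : set X := \bigcup_x A x.

Definition zeros A : set X := [set x | A x 0].

Definition accretive A : Prop :=
  forall x1 y1 x2 y2 : X, A x1 y1 -> A x2 y2 -> 0 <= J (x1 - x2) (y1 - y2).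

Definition id_plus g A : X -> set X :=
  fun x => [set x + g *: y | y in A x].

Definition m_accretive A : Prop :=
  accretive A /\ forall g, 0 < g -> ran (id_plus g A) = setT.

Definition nearest (C : set X) (x : X) : set X :=
  [set c | C c /\ forall c', C c' -> `|x - c| <= `|x - c'|].

Definition proj_zeros A (x : X) : X := xget x (nearest (zeros A) x).

(* For A m-accretive and g >= 0, the default value is only used at g = 0 and z
   outside [dom A]; it makes [resolvent 0 A] the identity map. *)
Definition resolvent g A (z : X) : X := xget z [set x | id_plus g A x z].

Definition semigroup A t (x : X) : X :=
  lim ((fun n : nat => iter n (resolvent (t / n%:R) A) x) @ \oo).

End Operators.

Section Rates.
Context {R : realType}.
Implicit Types (a : nat -> R) (phi : nat -> nat).

Definition rate_of_convergence a phi : Prop :=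
  forall k n : nat, (phi k <= n)%N -> a n <= k.+1%:R^-1.

Definition rate_of_approximate_zeros a phi : Prop :=
  forall k : nat, exists2 n : nat, (n <= phi k)%N & a n <= k.+1%:R^-1.

Definition weak_modulus {X : completeNormedModType R} (A : X -> set X)
    (Omega : nat -> (nat -> nat) -> (nat -> nat)) : Prop :=
  forall (x y : nat -> X) (K : nat) (phi : nat -> nat),
    (forall n, A (x n) (y n) /\ `|x n| <= K%:R /\ `|y n| <= K%:R) ->
    rate_of_convergence
      (fun n => `|(J (x n - proj_zeros A (x n)) (y n) : R)|) phi ->
    rate_of_approximate_zeros
      (fun n => `|x n - proj_zeros A (x n)|) (Omega K phi).

(* The bound chi_k(j) for b = b_k. *)
Definition chi (b j : nat) : R :=
  (Num.ceil (2^-1 * b%:R ^+ 2 + 1 : R))%:~R * (j%:R + 1).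

End Rates.

(* Main.v *)
Require Import Defs.
From HB Require Import structures.
From mathcomp Require Import all_boot all_order all_algebra.
From mathcomp Require Import all_classical all_reals all_analysis.
From mathcomp Require Import ring lra.

(* The resolvent iterates x_(i+1) = (Id + hA)^-1 x_i, with velocities
   y_i = (x_i - x_(i+1)) / h in A x_(i+1), are a discrete substitute for the
   trajectory: no differentiability of the semigroup is needed.  The obtuse
   angle property of the projection P makes |x_i - P x_i|^2 / 2 decrease by at
   least h <y_i, J(x_(i+1) - P x_(i+1))> in each step, so up to time chi b n some
   pairing is at most 1 / (n+1) (the summand 1 in chi absorbs the discretization
   error as soon as h <= 1).  The weak modulus applied to these points yields a
   zero q close to the iterates at some time before chi, and iterates only get
   closer to q.  Kobayashi's inequality compares iterates with different step
   sizes; it gives the convergence of the exponential formula and lets S(s)x and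
   S(s')x be approximated along a single discrete trajectory.  The functional
   J(x) is obtained as |x| times the directional derivative of the norm, which
   is linear by smoothness, so that Hahn-Banach is not needed. *)

Set Implicit Arguments.
Unset Strict Implicit.
Unset Printing Implicit Defensive.

Import Order.TTheory GRing.Theory Num.Theory.
Import numFieldNormedType.Exports.

Local Open Scope classical_set_scope.
Local Open Scope ring_scope.

(** * Directional derivatives of the norm and the duality map *)

Section DualityMap.
Context {R : realType} {X : completeNormedModType R}.

Lemma smooth_at (Xsmooth : uniformly_smooth X) (x : X) (e : R) :
  x != 0 -> 0 < e -> exists2 d : R, 0 < d &
    forall y : X, `|y| <= d -> `|x + y| + `|x - y| <= 2 * `|x| + e * `|y|.
Proof.
move=> x0 /Xsmooth [d d0 smooth_d]; have nx0 : 0 < `|x| by rewrite normr_gt0.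
have nxV : `| `|x|^-1 | = `|x|^-1 by rewrite ger0_norm// invr_ge0.
exists (d * `|x|) => [|y yd]; first exact: mulr_gt0.
have := smooth_d (`|x|^-1 *: x) (`|x|^-1 *: y).
rewrite -scalerDr -scalerBr !normrZ nxV mulVf ?gt_eqF// => /(_ erefl).
rewrite ler_pdivrMl// mulrC -mulrDr ler_pdivrMl// => /(_ yd).
rewrite [leRHS](_ : _ = 2 * `|x| + e * `|y|)//.
by field; rewrite gt_eqF.
Qed.

Let quotients (x y : X) : set R :=
  [set (`|x + t *: y| - `|x|) / t | t in [set t : R | 0 < t]].

(** By convexity of the norm the quotients are nondecreasing in [t], so this infimum is the right
    derivative of the norm at [x] along [y]. *)
Definition norm_deriv (x y : X) : R := inf (quotients x y).

Lemma quotient_le_norm (x y : X) t : 0 < t -> `|(`|x + t *: y| - `|x|) / t| <= `|y|.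
Proof.
move=> t0; rewrite normrM normfV (gtr0_norm t0) ler_pdivrMr//.
rewrite (le_trans (ler_dist_dist _ _))// addrAC subrr add0r normrZ.
by rewrite gtr0_norm// mulrC.
Qed.

Lemma norm_deriv_le (x y : X) t : 0 < t ->
  norm_deriv x y <= (`|x + t *: y| - `|x|) / t.
Proof.
move=> t0; apply: ge_inf; last by exists t.
exists (- `|y|) => _ [s /= s0 <-].
by have := quotient_le_norm x y s0; rewrite ler_norml => /andP[].
Qed.

Lemma norm_deriv_ge (x y : X) c :
  (forall t, 0 < t -> c <= (`|x + t *: y| - `|x|) / t) -> c <= norm_deriv x y.
Proof.
move=> cP; apply: lb_le_inf; last by move=> _ [t /= t0 <-]; exact: cP.
by exists ((`|x + 1 *: y| - `|x|) / 1), 1 => //=.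
Qed.

Lemma norm_deriv_le_norm (x y : X) : `|norm_deriv x y| <= `|y|.
Proof.
rewrite ler_norml; apply/andP; split.
  apply: norm_deriv_ge => t t0.
  by have := quotient_le_norm x y t0; rewrite ler_norml => /andP[].
apply: le_trans (norm_deriv_le x y ltr01) _.
by have := quotient_le_norm x y ltr01; rewrite ler_norml => /andP[].
Qed.

Lemma norm_deriv_self (x : X) : norm_deriv x x = `|x|.
Proof.
have q (t : R) : 0 < t -> (`|x + t *: x| - `|x|) / t = `|x|.
  move=> t0; rewrite -{1}[x]scale1r -scalerDl normrZ ger0_norm; last lra.
  by field; rewrite gt_eqF.
apply/eqP; rewrite eq_le; apply/andP; split.
  by rewrite -[leRHS](q _ ltr01) norm_deriv_le.
by apply: norm_deriv_ge => t t0; rewrite q.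
Qed.

Lemma norm_deriv_subadd (x y z : X) :
  norm_deriv x (y + z) <= norm_deriv x y + norm_deriv x z.
Proof.
rewrite -lerBlDr; apply: norm_deriv_ge => t t0; rewrite lerBlDr -lerBlDl.
apply: norm_deriv_ge => s s0; rewrite lerBlDl.
have st0 : 0 < s + t by rewrite addr_gt0.
(* [x + r(y+z)] is a convex combination of [x + ty] and [x + sz] when r is the
   harmonic sum of t and s *)
pose r := s * t / (s + t); have r0 : 0 < r by rewrite divr_gt0// mulr_gt0.
apply: le_trans (norm_deriv_le _ _ r0) _; rewrite ler_pdivrMr//.
have -> : x + r *: (y + z) =
    (s / (s + t)) *: (x + t *: y) + (t / (s + t)) *: (x + s *: z).
  rewrite !scalerDr !scalerA addrACA -scalerDl -mulrDl divff ?gt_eqF// scale1r.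
  by congr (_ + (_ *: _ + _ *: _)); rewrite /r; field; rewrite gt_eqF.
rewrite lerBlDr (le_trans (ler_normD _ _))// !normrZ !gtr0_norm ?invr_gt0//.
rewrite le_eqVlt; apply/orP; left; apply/eqP.
by rewrite /r; field; rewrite ?gt_eqF.
Qed.

Lemma norm_derivZ (x y : X) c : 0 < c -> norm_deriv x (c *: y) = c * norm_deriv x y.
Proof.
have le (a : R) z : 0 < a -> a * norm_deriv x z <= norm_deriv x (a *: z).
  move=> a0; apply: norm_deriv_ge => t t0; rewrite scalerA.
  have ta0 : 0 < t * a by rewrite mulr_gt0.
  rewrite -ler_pdivlMl//; apply: le_trans (norm_deriv_le _ _ ta0) _.
  by rewrite le_eqVlt; apply/orP; left; apply/eqP; field; rewrite ?gt_eqF.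
move=> c0; apply/eqP; rewrite eq_le le// andbT.
have cV0 : 0 < c^-1 by rewrite invr_gt0.
by rewrite -ler_pdivrMl// (le_trans (le _ _ cV0))// scalerA mulVf ?gt_eqF// scale1r.
Qed.

(** The derivatives along [y] and [- y] add up to at least 0 by subadditivity, and to at most any
    [e > 0] by smoothness. *)
Lemma norm_derivN (Xsmooth : uniformly_smooth X) (x y : X) :
  x != 0 -> norm_deriv x (- y) = - norm_deriv x y.
Proof.
move=> x0; apply/eqP; rewrite -subr_eq0 opprK eq_le; apply/andP; split; last first.
  apply: le_trans (norm_deriv_subadd _ _ _); rewrite addNr.
  by apply: norm_deriv_ge => t t0; rewrite scaler0 addr0 subrr mul0r.
have [->|y0] := eqVneq y 0.
  have := norm_deriv_le_norm x 0; rewrite normr0 normr_le0 => /eqP dx0.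
  by rewrite oppr0 dx0 addr0.
have ny0 : 0 < `|y| by rewrite normr_gt0.
apply/ler_addgt0Pr => e e0; rewrite add0r.
(* The increment has norm exactly [d]; dividing [e] by the norm of [y] makes the two quotients add
   up to at most [e]. *)
have [d d0 /(_ ((d / `|y|) *: y))] := smooth_at Xsmooth x0 (divr_gt0 e0 ny0).
have t0 : 0 < d / `|y| by rewrite divr_gt0.
rewrite normrZ gtr0_norm// divfK ?gt_eqF// => /(_ (lexx _)) H.
apply: le_trans (lerD (norm_deriv_le _ _ t0) (norm_deriv_le _ _ t0)) _.
rewrite -mulrDl ler_pdivrMr// scalerN.
by rewrite (_ : e * _ = e / `|y| * d); [lra | field; rewrite gt_eqF].
Qed.

(** An odd sublinear function is linear: superadditivity comes from [y = (y + z) - z]. *)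
Lemma norm_deriv_linear (Xsmooth : uniformly_smooth X) (x : X) :
  x != 0 -> linear (norm_deriv x : X -> R^o).
Proof.
move=> x0.
have D y z : norm_deriv x (y + z) = norm_deriv x y + norm_deriv x z.
  apply/eqP; rewrite eq_le norm_deriv_subadd/= -lerBrDr -norm_derivN//.
  by rewrite -{1}[y](addrK z) norm_deriv_subadd.
move=> c y z; rewrite D; congr (_ + _).
have [c0|c0|->] := ltgtP c 0; last 2 first.
- exact: norm_derivZ.
- rewrite !scale0r; apply/eqP; rewrite -normr_le0.
  by rewrite (le_trans (norm_deriv_le_norm _ _))// normr0.
rewrite -[c]opprK scaleNr norm_derivN// norm_derivZ ?oppr_gt0//.
by rewrite [in RHS]scaleNr.
Qed.

Lemma duality_set_nonempty (Xsmooth : uniformly_smooth X) (x : X) :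
  duality_set x !=set0.
Proof.
have [->|x0] := eqVneq x 0.
  exists (\0 : {linear X -> R^o}); split; first exact: cst_continuous.
  split; first by rewrite normr0 expr0n.
  rewrite /dual_norm (_ : [set _ | _ in _] = [set 0]) ?sup1 ?normr0//.
  apply/seteqP; split => [_ [y _ <-]|_ ->]; first by rewrite /= normr0.
  by exists 0; rewrite /= ?normr0.
have lin : linear (fun y => `|x| *: (norm_deriv x y : R^o) : R^o).
  by move=> c y z; rewrite norm_deriv_linear// scalerDr !scalerA mulrC.
pose f : {linear X -> R^o} := HB.pack (fun y => `|x| *: (norm_deriv x y : R^o) : R^o)
  (GRing.isLinear.Build _ _ _ _ _ lin).
have f_le y : `|f y| <= `|x| * `|y|.
  by rewrite normrM normr_id ler_wpM2l// norm_deriv_le_norm.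
exists f; split; last split.
- apply: bounded_linear_continuous; apply/linear_boundedP.
  exists `|x|; split; first exact: num_real.
  by move=> M xM y; rewrite (le_trans (f_le _))// ler_wpM2r// ltW.
- by rewrite /= norm_deriv_self expr2.
have bnd : ubound [set `|f y| | y in [set y : X | `|y| <= 1]] `|x|.
  by move=> _ [y /= y1 <-]; rewrite (le_trans (f_le _))// ler_piMr.
apply/eqP; rewrite eq_le; apply/andP; split.
  by apply: ge_sup => //; exists `|f 0|, 0; rewrite //= normr0.
apply: ub_le_sup; first by exists `|x|.
have nx0 : `|x| != 0 by rewrite normr_eq0.
have nxV : `| `|x|^-1 | = `|x|^-1 by rewrite ger0_norm// invr_ge0.
(* The unit vector along [x] attains the dual norm. *)
exists (`|x|^-1 *: x); first by rewrite /= normrZ nxV mulVf.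
rewrite linearZ /= norm_deriv_self /GRing.scale /= mulrA mulVf// mul1r.
by rewrite normr_id.
Qed.

Lemma J_self (Xsmooth : uniformly_smooth X) (x : X) : (J x x : R) = `|x| ^+ 2.
Proof.
by have [_ []] := xgetPex (\0 : {linear X -> R^o}) (duality_set_nonempty Xsmooth x).
Qed.

Lemma J_le (Xsmooth : uniformly_smooth X) (x y : X) : (J x y : R) <= `|x| * `|y|.
Proof.
have [] := xgetPex (\0 : {linear X -> R^o}) (duality_set_nonempty Xsmooth x).
rewrite -/(J x) => cJ [_ nJ].
have [->|y0] := eqVneq y 0; first by rewrite linear0 normr0 mulr0.
have ny0 : 0 < `|y| by rewrite normr_gt0.
apply: le_trans (ler_norm _) _; rewrite -ler_pdivrMr// -nJ.
apply: ub_le_sup.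
  (* Continuity bounds the set in [dual_norm], so its [sup] is a true least upper bound. *)
  have /linear_boundedP/pinfty_ex_gt0[M M0 JM] :=
    @continuous_linear_bounded _ _ _ 0 _ (cJ 0).
  by exists M => _ [z /= z1 <-]; rewrite (le_trans (JM _))// ler_piMr// ltW.
have nyV : `| `|y|^-1 | = `|y|^-1 by rewrite ger0_norm// invr_ge0.
exists (`|y|^-1 *: y); first by rewrite /= normrZ nyV mulVf// gt_eqF.
by rewrite linearZ /= /GRing.scale /= normrM nyV mulrC.
Qed.

End DualityMap.

(** * Uniform convexity and nearest points *)

Section Convexity.
Context {R : realType} {X : completeNormedModType R}.

Lemma cauchy_seq_cvg (u : nat -> X) :
  (forall e : R, 0 < e -> exists N, forall m n, (N <= m)%N -> (N <= n)%N ->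
    `|u m - u n| < e) -> cvg (u @ \oo).
Proof.
move=> uc; apply/cauchy_cvgP/cauchy_exP => e /uc[N uN].
by exists (u N); exists N => // n /= Nn; rewrite -ball_normE /=; exact: uN.
Qed.

Lemma uniformly_convex_scale (Xconvex : uniformly_convex X) (e : R) :
  0 < e -> e <= 2 -> exists2 d : R, 0 < d & forall (r : R) (x y : X),
    0 < r -> `|x| <= r -> `|y| <= r -> e * r <= `|x - y| ->
    `|2^-1 *: (x + y)| <= (1 - d) * r.
Proof.
move=> e0 e2; have [d d0 dP] := Xconvex e e0 e2; exists d => // r x y r0 xr yr exy.
have rV : `|r^-1| = r^-1 by rewrite ger0_norm// invr_ge0 ltW.
have := dP (r^-1 *: x) (r^-1 *: y); rewrite -scalerBr -scalerDr !normrZ rV.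
rewrite mulrCA !ler_pdivrMl// ler_pdivlMl// !mulr1 [r * e]mulrC.
by move=> /(_ xr yr exy); rewrite [r * _]mulrC.
Qed.

Lemma uniformly_convex_strict (Xconvex : uniformly_convex X) (r : R) (x y : X) :
  `|x| <= r -> `|y| <= r -> 2 * r <= `|x + y| -> x = y.
Proof.
move=> xr yr rxy; apply/eqP; apply: contraT => xy.
have xy0 : 0 < `|x - y| by rewrite normr_gt0 subr_eq0.
have xy2 : `|x - y| <= 2 * r by have := ler_normB x y; lra.
have r0 : 0 < r by lra.
have [||d d0 /(_ r x y r0 xr yr)] :=
  uniformly_convex_scale Xconvex (e := `|x - y| / r).
- exact: divr_gt0.
- by rewrite ler_pdivrMr.
rewrite divfK ?gt_eqF// lexx => /(_ isT).
rewrite normrZ ger0_norm// => H; have : 0 < d * r by rewrite mulr_gt0.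
lra.
Qed.

(** Midpoints carry the Cauchy argument for nearest points, and by iteration they give the dyadic
    points of a segment used for the obtuse angle. *)
Definition midpoint_convex (C : set X) :=
  forall x y, C x -> C y -> C (2^-1 *: (x + y)).

Lemma mid_sub (x y z : X) : z - 2^-1 *: (x + y) = 2^-1 *: ((z - x) + (z - y)).
Proof.
rewrite addrACA -opprD scalerBr; congr (_ - _).
by rewrite -mulr2n -(scaler_nat 2 z) scalerA mulVf ?scale1r// pnatr_eq0.
Qed.

(** Minimizing sequences are Cauchy: the midpoint of two almost nearest points far apart would be
    closer to [x] than the distance [D]. *)
Lemma nearest_nonempty (Xconvex : uniformly_convex X) (C : set X) (x : X) :
  C !=set0 -> closed C -> midpoint_convex C -> nearest C x !=set0.
Proof.
move=> [c0 Cc0] clC midC; pose E := [set `|x - c| | c in C]; pose D := inf E.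
have D_le c : C c -> D <= `|x - c|.
  by move=> Cc; apply: ge_inf; [exists 0 => _ [? _ <-]|exists c].
have D_ge0 : 0 <= D by apply: lb_le_inf; [exists `|x - c0|, c0|move=> _ [? _ <-]].
have infE : has_inf E by split; [exists `|x - c0|, c0|exists 0 => _ [? _ <-]].
have near_inf e : 0 < e -> exists2 eta : R, 0 < eta & forall c c', C c -> C c' ->
    `|x - c| <= D + eta -> `|x - c'| <= D + eta -> `|c - c'| < e.
  move=> e0; move: D_ge0; rewrite le_eqVlt => /predU1P[D0|D_gt0].
    exists (e / 3) => [|c c' _ _]; first by rewrite divr_gt0.
    have := ler_normB (x - c') (x - c).
    by rewrite opprB addrC addrA subrK -D0 => *; lra.
  have m0 : 0 < Num.min e D by rewrite lt_min e0.
  have mD : Num.min e D <= D by rewrite ge_min lexx orbT.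
  have me : Num.min e D <= e by rewrite ge_min lexx.
  (* The radius [D + eta] below is at most [2 * D], hence the divisor; the cap at [D] keeps the
     ratio in the range of uniform convexity. *)
  have [||d d0 dP] := uniformly_convex_scale Xconvex (e := Num.min e D / (2 * D)).
  - by rewrite divr_gt0// mulr_gt0.
  - by rewrite ler_pdivrMr ?mulr_gt0//; lra.
  (* The bound [eta < d * D] yields [(1 - d) * (D + eta) < D]. *)
  have [eta [eta0 etaD etad]] : exists eta : R, [/\ 0 < eta, eta <= D & eta < d * D].
    have dD : 0 < d * D by rewrite mulr_gt0.
    exists (Num.min D (d * D / 2)).
    rewrite lt_min ge_min lexx gt_min D_gt0/=; split => //.
      by rewrite divr_gt0.
    by apply/orP; right; lra.
  exists eta => // c c' Cc Cc' xc xc'; rewrite ltNge; apply/negP => ecc'.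
  have r0 : 0 < D + eta by lra.
  have := dP (D + eta) _ _ r0 xc xc'; rewrite -mid_sub.
  have -> : x - c - (x - c') = c' - c by rewrite opprB addrC addrA subrK.
  have H : Num.min e D / (2 * D) * (D + eta) <= `|c' - c|.
    rewrite distrC (le_trans _ ecc')// (le_trans _ me)// -mulrA ger_pMr//.
    by rewrite ler_pdivrMl ?mulr_gt0//; lra.
  have := D_le _ (midC _ _ Cc Cc') => Dm /(_ H).
  have : 0 < d * eta by rewrite mulr_gt0.
  nra.
have /choice[c cP] n : exists c, C c /\ `|x - c| < D + n.+1%:R^-1.
  have n0 : (0 : R) < n.+1%:R^-1 by rewrite invr_gt0.
  by have [_ [c Cc <-] lt_c] := inf_adherent n0 infE; exists c.
have small (e : R) : 0 < e -> exists N, forall n, (N <= n)%N -> n.+1%:R^-1 < e.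
  move=> e0; have [N _ NP] := near_infty_natSinv_lt (PosNum e0).
  by exists N => n Nn; exact: NP.
have ccvg : cvg (c @ \oo).
  apply: cauchy_seq_cvg => e /near_inf[eta eta0 etaP]; have [N NP] := small _ eta0.
  exists N => m n Nm Nn; have [[Cm xm] [Cn xn]] := (cP m, cP n).
  apply: etaP => //; apply/ltW.
    by rewrite (lt_trans xm)// ltrD2l NP.
  by rewrite (lt_trans xn)// ltrD2l NP.
exists (lim (c @ \oo)); split.
  by apply: (closed_cvg _ clC _ _ ccvg); near=> n; have [] := cP n.
move=> c' /D_le; apply: le_trans; apply/ler_addgt0Pr => e e0.
have e20 : 0 < e / 2 by rewrite divr_gt0.
have /cvgrPdist_lt/(_ _ e20)[N1 _ N1P] := ccvg.
have [N2 N2P] := small _ e20; pose n := maxn N1 N2.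
have := N1P n (leq_maxl _ _); have := N2P n (leq_maxr _ _); have [_] := cP n.
have := ler_distD (c n) x (lim (c @ \oo)); rewrite [`|c n - _|]distrC /=.
move: (n.+1%:R^-1 : R) => i *; lra.
Unshelve. all: by end_near. Qed.

(** Moving [c] towards [q] by a small [t] cannot shorten [z], so smoothness bounds the norm of
    [z + t *: w] by that of [z] up to o(t); pairing this vector with [J z] bounds [J z w]. *)
Lemma nearest_obtuse (Xsmooth : uniformly_smooth X) (C : set X) (x c q : X) :
  midpoint_convex C -> nearest C x c -> C q -> (J (x - c) (q - c) : R) <= 0.
Proof.
move=> midC [Cc cP] Cq; set z := x - c; set w := q - c.
have [z0|z0] := eqVneq z 0.
  by rewrite (le_trans (J_le Xsmooth _ _))// z0 normr0 mul0r.
have nz0 : 0 < `|z| by rewrite normr_gt0.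
have seg n : C (c + 2^-1 ^+ n *: w).
  elim: n => [|n IH]; first by rewrite expr0 scale1r addrC subrK.
  have := midC _ _ Cc IH; rewrite addrA scalerDr scalerA -exprS.
  by rewrite -mulr2n -(scaler_nat 2 c) scalerA mulVf ?scale1r// pnatr_eq0.
apply/ler_addgt0Pr => e e0; rewrite add0r.
(* This divisor of [e] cancels the factors that appear at the end; the 1 covers [w = 0]. *)
have k0 : 0 < `|z| * (`|w| + 1) by rewrite mulr_gt0// ltr_wpDl.
have [d d0 dP] := smooth_at Xsmooth z0 (divr_gt0 e0 k0).
pose n := (Num.truncn (`|w| / d)).+1; pose t : R := 2^-1 ^+ n.
have t0 : 0 < t by rewrite exprn_gt0// invr_gt0.
have tw : `|t *: w| <= d.
  rewrite normrZ gtr0_norm// /t exprVn mulrC ler_pdivrMr ?exprn_gt0// -ler_pdivrMl//.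
  rewrite mulrC (le_trans (ltW (truncnS_gt _)))//.
  by rewrite -natrX ler_nat ltnW// ltn_expl.
have ztw : `|z| <= `|z - t *: w|.
  by rewrite /z -addrA -opprD; exact: cP (seg n).
have := dP _ tw; have := J_le Xsmooth z (z + t *: w).
rewrite linearD linearZ /= J_self// => JH H.
have {}H : `|z + t *: w| <= `|z| + e / (`|z| * (`|w| + 1)) * `|t *: w| by lra.
have : `|z| ^+ 2 + t * J z w <= `|z| * (`|z| + e / (`|z| * (`|w| + 1)) * `|t *: w|).
  by rewrite (le_trans JH)// ler_pM2l.
rewrite mulrDr -expr2 lerD2l normrZ gtr0_norm// => H2.
rewrite -(ler_pM2l t0) (le_trans H2)//.
have w1 : 0 < `|w| + 1 by rewrite ltr_wpDl.
rewrite (_ : `|z| * _ = t * e * (`|w| / (`|w| + 1))); last first.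
  by field; rewrite ?gt_eqF.
rewrite ler_piMr ?mulr_ge0 ?(ltW t0) ?(ltW e0)//.
by rewrite ler_pdivrMr//; lra.
Qed.

End Convexity.

(** * Resolvents, zeros and Kobayashi's inequality *)

Section Resolvents.
Context {R : realType} {X : completeNormedModType R}.
Variable A : X -> set X.
Hypotheses (Xsmooth : uniformly_smooth X) (Amacc : m_accretive A).

(** Pairing the right-hand difference with [J (x1 - x2)] gives the square of the left-hand norm plus
    a nonnegative term. *)
Lemma accretive_expansive (g : R) (x1 y1 x2 y2 : X) : 0 <= g ->
  A x1 y1 -> A x2 y2 -> `|x1 - x2| <= `|(x1 + g *: y1) - (x2 + g *: y2)|.
Proof.
move=> g0 A1 A2; have [/eqP|d0] := eqVneq (x1 - x2) 0.
  by rewrite subr_eq0 => /eqP ->; rewrite subrr normr0.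
rewrite -(ler_pM2l (_ : 0 < `|x1 - x2|)) ?normr_gt0//.
rewrite -expr2 -J_self// (le_trans _ (J_le Xsmooth _ _))//.
rewrite opprD addrACA -scalerBr [leRHS]linearD [J _ (g *: _)]linearZ lerDl.
by rewrite mulr_ge0//; case: Amacc => acc _; exact: acc.
Qed.

Lemma resolvent_in (g : R) (z : X) : 0 < g ->
  A (resolvent g A z) (g^-1 *: (z - resolvent g A z)).
Proof.
move=> g0; have [x _ xz] : ran (id_plus g A) z by case: Amacc => _ ->.
have /= [y Ay yz] := xgetPex z (ex_intro (fun x => id_plus g A x z) x xz).
rewrite -/(resolvent g A z) in Ay yz.
by rewrite -{2}yz addrAC subrr add0r scalerA mulVf ?gt_eqF// scale1r.
Qed.

Lemma resolvent_eq (g : R) (x y : X) : 0 < g -> A x y ->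
  resolvent g A (x + g *: y) = x.
Proof.
move=> g0 Axy; apply/eqP; rewrite -subr_eq0 -normr_le0.
have := accretive_expansive (ltW g0) (resolvent_in (x + g *: y) g0) Axy.
by rewrite scalerA divff ?gt_eqF// scale1r subrKC subrr normr0.
Qed.

Lemma resolvent_nonexpansive (g : R) (z w : X) : 0 < g ->
  `|resolvent g A z - resolvent g A w| <= `|z - w|.
Proof.
move=> g0.
have := accretive_expansive (ltW g0) (resolvent_in z g0) (resolvent_in w g0).
by rewrite !scalerA !divff ?gt_eqF// !scale1r !subrKC.
Qed.

Lemma iter_resolvent_nonexpansive (g : R) n (z w : X) : 0 < g ->
  `|iter n (resolvent g A) z - iter n (resolvent g A) w| <= `|z - w|.
Proof.
move=> g0; elim: n => //= n; apply: le_trans.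
exact: resolvent_nonexpansive.
Qed.

Lemma resolvent_zero (g : R) (q : X) : 0 < g -> zeros A q -> resolvent g A q = q.
Proof. by move=> g0 /(resolvent_eq g0); rewrite scaler0 addr0. Qed.

Lemma zeros_resolvent (q : X) : resolvent 1 A q = q -> zeros A q.
Proof. by move=> eq; have := resolvent_in q ltr01; rewrite eq subrr scaler0. Qed.

Lemma zeros_closed : closed (zeros A).
Proof.
move=> q clq; apply: zeros_resolvent; apply/eqP; rewrite -subr_eq0 -normr_le0.
apply/ler_addgt0Pr => e e0; have e20 : 0 < e / 2 by rewrite divr_gt0.
have [c [zc]] := clq _ (nbhsx_ballx q _ e20).
rewrite -ball_normE /= add0r => qc.
have := resolvent_nonexpansive q c ltr01; rewrite (resolvent_zero _ zc)// => H.
by have := ler_distD c (resolvent 1 A q) q; rewrite [`|c - q|]distrC; lra.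
Qed.

(** The resolvent moves [m] to a point within half of the distance of [p] and [q] from both; strict
    convexity leaves only the midpoint. *)
Lemma zeros_midpoint_convex (Xconvex : uniformly_convex X) :
  midpoint_convex (zeros A).
Proof.
move=> p q zp zq; set m := 2^-1 *: (p + q); apply: zeros_resolvent.
set T := resolvent 1 A; pose r := `|2^-1 *: (p - q)|.
have mp : m - p = 2^-1 *: (q - p).
  by rewrite -[LHS]opprB mid_sub subrr add0r -scalerN opprB.
have mq : m - q = 2^-1 *: (p - q).
  by rewrite -[LHS]opprB mid_sub subrr addr0 -scalerN opprB.
have Tp : `|T m - p| <= r.
  have := resolvent_nonexpansive m p ltr01; rewrite (resolvent_zero _ zp)// mp.
  by rewrite /r !normrZ [`|p - q|]distrC.
have Tq : `|q - T m| <= r.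
  have := resolvent_nonexpansive m q ltr01; rewrite (resolvent_zero _ zq)// mq.
  by rewrite distrC.
have TE : T m - p = q - T m.
  apply: (uniformly_convex_strict Xconvex Tp Tq).
  rewrite /r normrZ ger0_norm// mulVKf ?pnatr_eq0//.
  by rewrite [X in _ <= `|X|]addrC addrA subrK distrC.
have : 2 *: T m = 2 *: m.
  rewrite scalerA divff ?pnatr_eq0// scale1r -[2]/(1 + 1) scalerDl scale1r.
  by rewrite -{1}(subrK p (T m)) TE addrAC subrK addrC.
by move/(scalerI (_ : 2 != 0)); apply; rewrite pnatr_eq0.
Qed.

Lemma nearest_proj_zeros (Xconvex : uniformly_convex X) (p : X) (x : X) :
  zeros A p -> nearest (zeros A) x (proj_zeros A x).
Proof.
move=> zp; apply: (xgetPex x); apply: nearest_nonempty => //; first by exists p.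
- exact: zeros_closed.
- exact: zeros_midpoint_convex.
Qed.

(** Accretivity at the two resolvent points [x] and [y], multiplied by [g * h], says that
    [(g + h) *: (x - y)] paired with [J (x - y)] is at most the pairing of
    [h *: (z - y) + g *: (x - w)]. *)
Lemma kobayashi_step (g h : R) (z w : X) : 0 < g -> 0 < h ->
  (g + h) * `|resolvent g A z - resolvent h A w| <=
  h * `|z - resolvent h A w| + g * `|resolvent g A z - w|.
Proof.
move=> g0 h0; have [acc _] := Amacc.
have := acc _ _ _ _ (resolvent_in z g0) (resolvent_in w h0).
set x := resolvent g A z; set y := resolvent h A w => acc_xy.
have [->|d0] := eqVneq (x - y) 0.
  by rewrite normr0 mulr0 addr_ge0// mulr_ge0// ltW.
have d_gt0 : 0 < `|x - y| by rewrite normr_gt0.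
have := J_le Xsmooth (x - y) (z - y); have := J_le Xsmooth (x - y) (x - w).
have := J_self Xsmooth (x - y); move: acc_xy.
rewrite !linearB !linearZ /= /GRing.scale /=.
set jx : R := J _ x; set jy : R := J _ y; set jz : R := J _ z; set jw : R := J _ w.
move=> H E Jxw Jzy; rewrite -(ler_pM2l d_gt0).
have {}H : 0 <= h * (jz - jx) - g * (jw - jy).
  rewrite (_ : _ - _ = (g * h) *
    (g^-1 * jz + g^-1 * - jx + (h^-1 * - jw + h^-1 * - - jy))).
    by rewrite mulr_ge0// ltW// mulr_gt0.
  by field; rewrite ?gt_eqF.
rewrite mulrCA -expr2 -E [leRHS]mulrDr.
rewrite [X in _ <= X + _]mulrCA [X in _ <= _ + X]mulrCA.
have := ler_wpM2l (ltW h0) Jzy; have := ler_wpM2l (ltW g0) Jxw; lra.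
Qed.

Lemma kobayashi (g h : R) (u v : X) i j : 0 < g -> 0 < h -> A u v ->
  `|iter i (resolvent g A) u - iter j (resolvent h A) u| ^+ 2 <=
  `|v| ^+ 2 * ((i%:R * g - j%:R * h) ^+ 2 + i%:R * g ^+ 2 + j%:R * h ^+ 2).
Proof.
move=> g0 h0 Auv.
(* Since [u] is the resolvent of [u + l *: v], each step moves by at most [l] times the norm of [v].
   This settles the boundary cases of the double induction. *)
have drift (l : R) n : 0 < l -> `|iter n (resolvent l A) u - u| <= n%:R * l * `|v|.
  move=> l0; elim: n => [|n IH]; first by rewrite subrr normr0 !mul0r.
  rewrite iterSr (le_trans (ler_distD (iter n (resolvent l A) u) _ _))//.
  rewrite -natr1 2!mulrDl mul1r addrC lerD//.
  rewrite (le_trans (iter_resolvent_nonexpansive _ _ _ l0))//.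
  rewrite -[X in _ - X](resolvent_eq l0 Auv).
  rewrite (le_trans (resolvent_nonexpansive _ _ l0))//.
  by rewrite opprD addrA subrr add0r normrN normrZ gtr0_norm.
have sq (a b : R) : 0 <= a -> a <= b -> a ^+ 2 <= b ^+ 2.
  by move=> a0 ab; rewrite lerXn2r// nnegrE (le_trans a0).
elim: i j => [j|i IHi].
  rewrite !mul0r addr0 sub0r sqrrN /= distrC.
  apply: le_trans (sq _ _ (normr_ge0 _) (drift h j h0)) _.
  rewrite exprMn mulrC ler_wpM2l ?exprn_ge0// lerDl mulr_ge0 ?exprn_ge0//.
  exact: ltW.
elim=> [|j IHj].
  rewrite !mul0r addr0 subr0 /=.
  apply: le_trans (sq _ _ (normr_ge0 _) (drift g i.+1 g0)) _.
  rewrite exprMn mulrC ler_wpM2l ?exprn_ge0// lerDl mulr_ge0 ?exprn_ge0//.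
  exact: ltW.
have := kobayashi_step (iter i (resolvent g A) u) (iter j (resolvent h A) u) g0 h0.
rewrite -!iterS; move: (IHi j.+1) IHj.
set a := `|iter i _ u - iter j.+1 _ u|; set b := `|iter i.+1 _ u - iter j _ u|.
set c := `|iter i.+1 _ u - iter j.+1 _ u| => Ha Hb Hc.
rewrite -!natr1 in Ha Hb *.
have gh : 0 < g + h by rewrite addr_gt0.
(* convexity of the square turns the step estimate into a recursion for the
   squares, which the right-hand side satisfies with equality *)
have cvx : (g + h) * c ^+ 2 <= h * a ^+ 2 + g * b ^+ 2.
  have : ((g + h) * c) ^+ 2 <= (h * a + g * b) ^+ 2.
    by apply: (sq _ _ (mulr_ge0 (ltW gh) (normr_ge0 _))).
  move=> /le_trans H; rewrite -(ler_pM2l gh) mulrA -expr2 -exprMn; apply: H.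
  rewrite -subr_ge0 (_ : _ - _ = g * h * (a - b) ^+ 2); last by ring.
  by rewrite mulr_ge0 ?sqr_ge0// mulr_ge0 ?ltW.
rewrite -(ler_pM2l gh) (le_trans cvx)//.
apply: le_trans (lerD (ler_wpM2l (ltW h0) Ha) (ler_wpM2l (ltW g0) Hb)) _.
by rewrite le_eqVlt; apply/orP; left; apply/eqP; ring.
Qed.

End Resolvents.

(** * The exponential formula and discrete trajectories *)

Section Trajectories.
Context {R : realType} {X : completeNormedModType R}.
Variable A : X -> set X.
Hypotheses (Xsmooth : uniformly_smooth X) (Amacc : m_accretive A).

Lemma kobayashi_dist (g h M : R) (u v : X) i j : 0 < g -> 0 < h -> 0 <= M ->
  A u v ->
  `|v| ^+ 2 * ((i%:R * g - j%:R * h) ^+ 2 + i%:R * g ^+ 2 + j%:R * h ^+ 2)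
    <= M ^+ 2 ->
  `|iter i (resolvent g A) u - iter j (resolvent h A) u| <= M.
Proof.
move=> g0 h0 M0 Auv le_M; rewrite -(@ler_pXn2r _ 2)// ?nnegrE//.
exact: le_trans (kobayashi Xsmooth Amacc i j g0 h0 Auv) le_M.
Qed.

Lemma le_invS_trunc (c d : R) n : 0 < d -> (Num.truncn (c / d) <= n)%N ->
  c * n.+1%:R^-1 <= d.
Proof.
move=> d0 cn; rewrite ler_pdivrMr// -ler_pdivrMl// mulrC.
by rewrite ltW// (lt_le_trans (truncnS_gt _))// ler_nat ltnS.
Qed.

(** At equal final times only the two quadratic terms of Kobayashi's bound remain, and they vanish
    as the steps shrink; nonexpansiveness passes from [u] in the domain to [x] in its closure. *)
Lemma semigroup_cvg (t : R) (x : X) : 0 < t -> closure (dom A) x ->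
  iter n (resolvent (t / n%:R) A) x @[n --> \oo] --> semigroup A t x.
Proof.
move=> t0 domx; apply: cauchy_seq_cvg => e e0.
have e30 : 0 < e / 4 by rewrite divr_gt0.
have [u [[v Auv]]] := domx _ (nbhsx_ballx x _ e30).
rewrite -ball_normE /= => xu.
pose c := 2 * (`|v| * t) ^+ 2.
(* The successor excludes index 0, where the step [t / 0] is 0. *)
exists (Num.truncn (c / (e / 4) ^+ 2)).+1 => -[//|m] [//|n] Nm Nn.
have ts k : 0 < t / k.+1%:R by rewrite divr_gt0.
have Hm := iter_resolvent_nonexpansive Xsmooth Amacc m.+1 x u (ts m).
have Hn := iter_resolvent_nonexpansive Xsmooth Amacc n.+1 x u (ts n).
have Hu : `|iter m.+1 (resolvent (t / m.+1%:R) A) u -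
            iter n.+1 (resolvent (t / n.+1%:R) A) u| <= e / 4.
  apply: (kobayashi_dist (ts m) (ts n) (ltW e30) Auv).
  have := le_invS_trunc (exprn_gt0 2 e30) Nm.
  have := le_invS_trunc (exprn_gt0 2 e30) Nn; rewrite /c.
  rewrite (_ : _ * (_ + _ + _) =
    (`|v| * t) ^+ 2 * m.+1%:R^-1 + (`|v| * t) ^+ 2 * n.+1%:R^-1).
    by move: (m.+1%:R^-1 : R) (n.+1%:R^-1 : R) => im jn; lra.
  by field; rewrite ?nat1r ?natr1 ?pnatr_eq0.
move: Hm Hn Hu; set xm := iter m.+1 _ x; set xn := iter n.+1 _ x.
set um := iter m.+1 _ u; set un := iter n.+1 _ u => Hm Hn Hu.
have := ler_distD um xm xn; have := ler_distD un um xn.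
by rewrite [`|un - xn|]distrC; lra.
Qed.

Variables (p : X).
Hypotheses (Xconvex : uniformly_convex X) (zp : zeros A p).

(** Accretivity against the pair of the projection and 0; it removes the absolute value in the weak
    modulus. *)
Lemma pairing_ge0 (x y : X) : A x y -> 0 <= (J (x - proj_zeros A x) y : R).
Proof.
move=> Axy; have [zP _] := nearest_proj_zeros Xsmooth Amacc Xconvex x zp.
by case: Amacc => /(_ _ _ _ _ Axy zP); rewrite subr0.
Qed.

(** Split [x - w] as [(x - Px) - (w - Pw) + (Px - Pw)]: the last term pairs nonpositively by the
    obtuse angle, and the rest is bounded by [2ab <= a^2 + b^2]. *)
Lemma pairing_step (h : R) (x : X) (w := resolvent h A x) : 0 < h ->
  h * J (w - proj_zeros A w) (h^-1 *: (x - w)) <=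
  2^-1 * (`|x - proj_zeros A x| ^+ 2 - `|w - proj_zeros A w| ^+ 2).
Proof.
move=> h0; have nw := nearest_proj_zeros Xsmooth Amacc Xconvex w zp.
have [zx _] := nearest_proj_zeros Xsmooth Amacc Xconvex x zp.
have mid := zeros_midpoint_convex Xsmooth Amacc Xconvex.
rewrite linearZ /= [_ *: _]/GRing.scale /= mulrA divff ?gt_eqF// mul1r.
have := nearest_obtuse Xsmooth mid nw zx.
set Px := proj_zeros A x in zx *; set Pw := proj_zeros A w.
have := J_le Xsmooth (w - Pw) (x - Px); have := J_self Xsmooth (w - Pw).
set z := w - Pw; rewrite !linearB /= => H1 H2 H3.
have : 0 <= (`|x - Px| - `|z|) ^+ 2 by apply: sqr_ge0.
lra.
Qed.

Section Trajectory.
Variables (h : R) (u v : X).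
Hypotheses (h0 : 0 < h) (Auv : A u v).

Let x i := iter i (resolvent h A) u.
Let y i := h^-1 *: (x i - x i.+1).
Let z i := x i - proj_zeros A (x i).

Lemma trajectory_in i : A (x i.+1) (y i).
Proof. exact: resolvent_in. Qed.

Lemma trajectory_dist i j q : zeros A q -> (i <= j)%N -> `|x j - q| <= `|x i - q|.
Proof.
move=> zq /subnK <-; rewrite /x iterD; elim: (j - i)%N => //= n; apply: le_trans.
rewrite -[X in _ - X](resolvent_zero Xsmooth Amacc h0 zq).
exact: resolvent_nonexpansive.
Qed.

(** Iterates never get farther from [p] than [u]; this is the source of [2 * |p|] in the bound on
    [K]. *)
Lemma trajectory_norm i : `|x i| <= `|u| + 2 * `|p|.
Proof.
have := trajectory_dist zp (leq0n i); have := ler_normB u p.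
have := ler_normD (x i - p) p; rewrite subrK /x /=; lra.
Qed.

(** Step lengths do not increase along the trajectory, and the first is controlled by [v]. *)
Lemma velocity_norm i : `|y i| <= `|v|.
Proof.
rewrite normrZ gtr0_norm ?invr_gt0// ler_pdivrMl// /x iterSr.
rewrite (le_trans (iter_resolvent_nonexpansive Xsmooth Amacc i _ _ h0))//.
rewrite -{1}(resolvent_eq Xsmooth Amacc h0 Auv).
rewrite (le_trans (resolvent_nonexpansive Xsmooth Amacc _ _ h0))//.
by rewrite addrAC subrr add0r normrZ gtr0_norm.
Qed.

Lemma pairing_sum (c : R) N : (forall i, (i < N)%N -> c <= J (z i.+1) (y i)) ->
  N%:R * h * c <= 2^-1 * (`|z 0| ^+ 2 - `|z N| ^+ 2).
Proof.
elim: N => [_|N IH cP]; first by rewrite !mul0r subrr mulr0.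
have := IH (fun i iN => cP i (ltnW iN)).
have := pairing_step (x N) h0; rewrite -/(x N.+1) -/(z N) -/(z N.+1) -/(y N) => S.
have := ler_wpM2l (ltW h0) (cP N (ltnSn N)); rewrite -[N.+1%:R]natr1; lra.
Qed.

Lemma small_pairing (b n : nat) : h <= 1 -> `|z 0| <= b%:R ->
  exists2 i, i.+1%:R * h <= chi b n & J (z i.+1) (y i) <= n.+1%:R^-1.
Proof.
move=> h1 zb; apply: contrapT => no_i.
have chi_ge : (2^-1 * b%:R ^+ 2 + 1) * n.+1%:R <= chi b n :> R.
  by rewrite /chi natr1 ler_wpM2r// Num.Theory.ceil_ge.
have chi_gt0 : 0 < chi b n :> R.
  by rewrite (lt_le_trans _ chi_ge)// mulr_gt0// ltr_wpDl// mulr_ge0.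
(* The [N] whole steps that fit before [chi b n] cover more than [chi b n - 1], as [h <= 1]. If all
   pairings exceeded the bound, their sum would be too large. *)
pose N := Num.truncn (chi b n / h).
have Nh : N%:R * h <= chi b n by rewrite -ler_pdivlMr// truncn_le ?divr_ge0 ?ltW.
have hN : chi b n < N.+1%:R * h by rewrite -ltr_pdivrMr// truncnS_gt.
have := @pairing_sum n.+1%:R^-1 N; have n0 : (0 : R) < n.+1%:R by [].
rewrite ler_pdivrMr// => H.
have {H} : N%:R * h <= 2^-1 * (`|z 0| ^+ 2 - `|z N| ^+ 2) * n.+1%:R.
  apply: H => i iN; rewrite ltW// ltNge; apply/negP => small.
  apply: no_i; exists i => //; apply: le_trans Nh.
  by rewrite ler_pM2r// ler_nat.
have : 2^-1 * (`|z 0| ^+ 2 - `|z N| ^+ 2) * n.+1%:R <= 2^-1 * b%:R ^+ 2 * n.+1%:R.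
  rewrite ler_pM2r// ler_pM2l// lerBlDr ler_wpDr ?sqr_ge0//.
  by rewrite lerXn2r// nnegrE.
have : (1 : R) <= n.+1%:R by rewrite ler1n.
move: hN; rewrite -[N.+1%:R]natr1; lra.
Qed.

End Trajectory.

Lemma trajectory_near_zero (Omega : nat -> (nat -> nat) -> (nat -> nat))
    (OmegaP : weak_modulus A Omega) (h : R) (u v : X) (b K j : nat) :
  0 < h -> h <= 1 -> A u v -> `|u - proj_zeros A u| <= b%:R ->
  `|u| + 2 * `|p| <= K%:R -> `|v| <= K%:R ->
  exists2 q, zeros A q & forall m : nat, chi b (Omega K id j) <= m%:R * h ->
    `|iter m (resolvent h A) u - q| <= j.+1%:R^-1.
Proof.
move=> h0 h1 Auv ub uK vK; pose x i := iter i (resolvent h A) u.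
pose y i := h^-1 *: (x i - x i.+1).
have /choice[i iP] n : exists i, i.+1%:R * h <= chi b n /\
    J (x i.+1 - proj_zeros A (x i.+1)) (y i) <= n.+1%:R^-1.
  by have [i] := small_pairing h0 n h1 ub; exists i.
have [n|n l nl|n nO xn] :=
  OmegaP (fun n => x (i n).+1) (fun n => y (i n)) K id _ _ j.
- split; first exact: trajectory_in.
  split; first exact: le_trans (trajectory_norm u h0 _) uK.
  exact: le_trans (velocity_norm h0 Auv _) vK.
(* The [l]-th chosen pairing is at most [1 / (l + 1)], so [id] is a rate of convergence. *)
- rewrite ger0_norm ?(pairing_ge0 (trajectory_in u h0 _))//.
  by rewrite (le_trans (iP l).2)// lef_pV2 ?posrE// ler_nat ltnS.
have [zq _] := nearest_proj_zeros Xsmooth Amacc Xconvex (x (i n).+1) zp.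
exists (proj_zeros A (x (i n).+1)) => // m chi_m.
apply: le_trans xn; apply: trajectory_dist => //.
(* The modulus only provides some [n] below [Omega K id j]; monotonicity of [chi] gives a time bound
   independent of [n]. *)
have chi_mono : chi b n <= chi b (Omega K id j) :> R.
  rewrite /chi !natr1 ler_wpM2l ?ler_nat// ler0z ceil_ge0.
  have : (0 : R) <= b%:R ^+ 2 by rewrite exprn_ge0.
  lra.
have := le_trans (le_trans (iP n).1 chi_mono) chi_m.
by rewrite ler_pM2r// ler_nat.
Qed.

End Trajectories.

(** * Comparison of two semigroup values along one trajectory *)

Theorem theorem4p4 (R : realType) (X : completeNormedModType R)
  (Xconvex : uniformly_convex X) (Xsmooth : uniformly_smooth X)
  (A : X -> set X) (Amacc : m_accretive A)
  (p : X) (zerop : zeros A p)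
  (Omega : nat -> (nat -> nat) -> (nat -> nat)) (OmegaP : weak_modulus A Omega)
  (x : X) (domx : closure (dom A) x)
  (f : nat -> nat) (f_nondecreasing : {homo f : m n / (m <= n)%N})
  (fP : forall n : nat, exists u v : X,
    [/\ A u v, `|u| <= (f n)%:R, `|v| <= (f n)%:R & `|u - x| <= n.+1%:R^-1]) :
  forall k b K : nat,
    `|x - proj_zeros A x| + `|x| + (f (3 * k + 2)%N)%:R <= b%:R ->
    (f (3 * k + 2)%N)%:R + 2 * `|p| <= K%:R ->
    forall s s' : R,
      chi b (Omega K id (6 * k + 5)%N) <= s ->
      chi b (Omega K id (6 * k + 5)%N) <= s' ->
      `|semigroup A s x - semigroup A s' x| <= k.+1%:R^-1.
Proof.
move=> k b K xb fK s s' chi_s chi_s'.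
have [u [v [Auv uf vf ux]]] := fP (3 * k + 2)%N.
have chi_gt0 j : 0 < chi b j :> R.
  rewrite /chi natr1 mulr_gt0// ltr0z ceil_gt0.
  by have : (0 : R) <= b%:R ^+ 2 by []; lra.
have s0 : 0 < s := lt_le_trans (chi_gt0 _) chi_s.
have s'0 : 0 < s' := lt_le_trans (chi_gt0 _) chi_s'.
(* The projection of [x] is a zero, hence no closer to [u] than the projection of [u]. *)
have ub : `|u - proj_zeros A u| <= b%:R.
  have [_ /(_ (proj_zeros A x))] := nearest_proj_zeros Xsmooth Amacc Xconvex u zerop.
  have [zx _] := nearest_proj_zeros Xsmooth Amacc Xconvex x zerop.
  move=> /(_ zx); have := ler_normB u x; have := ler_distD x u (proj_zeros A x); lra.
have uK : `|u| + 2 * `|p| <= K%:R by lra.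
have vK : `|v| <= K%:R by have := normr_ge0 p; lra.
pose i : R := k.+1%:R^-1.
have ux3 : `|x - u| <= i / 3.
  rewrite distrC (le_trans ux)// /i -invfM -natrM lef_pV2 ?posrE ?ltr0n//.
  by rewrite ler_nat mulSnr mulnC -addnS.
have i6 : (6 * k + 5).+1%:R^-1 = i / 6 :> R.
  by rewrite /i -invfM -natrM [(k.+1 * _)%N]mulSnr [(k * _)%N]mulnC -addnS.
apply/ler_addgt0Pr => e e0; have e30 : 0 < e / 3 by rewrite divr_gt0.
have /cvgrPdist_lt/(_ _ e30)[N1 _ N1P] := semigroup_cvg Xsmooth Amacc s0 domx.
have /cvgrPdist_lt/(_ _ e30)[N2 _ N2P] := semigroup_cvg Xsmooth Amacc s'0 domx.
(* [c / N.+1] will dominate Kobayashi's bound: with [m], [h], [h'] as below, [(m * h - s')^2 <= h],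
   [m * h^2 <= (s' + 1) * h] and [N.+1 * h'^2 = s' * h']. *)
pose c := `|v| ^+ 2 * (s + (s' + 1) * s + s' ^+ 2).
pose N := maxn (maxn N1 N2)
  (maxn (Num.truncn (s / 1)) (Num.truncn (c / (e / 3) ^+ 2))).
have NN1 : (N1 <= N.+1)%N by rewrite leqW// /N !leq_max leqnn ?orbT.
have NN2 : (N2 <= N.+1)%N by rewrite leqW// /N !leq_max leqnn ?orbT.
have H1 := N1P _ NN1; have H2 := N2P _ NN2.
pose h := s / N.+1%:R; pose h' := s' / N.+1%:R.
have h0 : 0 < h by rewrite divr_gt0.
have h'0 : 0 < h' by rewrite divr_gt0.
have h1 : h <= 1 by apply: le_invS_trunc => //; rewrite /N !leq_max leqnn ?orbT.
have cN : c * N.+1%:R^-1 <= (e / 3) ^+ 2.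
  by apply: le_invS_trunc; rewrite ?exprn_gt0// /N !leq_max leqnn ?orbT.
(* The trajectory of step [h] reaches [s] after [N.+1] steps and first passes [s'] after [m] steps,
   so one zero [q] serves both times. *)
pose m := (Num.truncn (s' / h)).+1.
have ms' : s' <= m%:R * h by rewrite -ler_pdivrMr// ltW// truncnS_gt.
have ms'h : m%:R * h <= s' + h.
  rewrite -natr1 mulrDl mul1r lerD2r -ler_pdivlMr// truncn_le//.
  by rewrite divr_ge0 ?ltW.
have [q zq qP] := trajectory_near_zero Xsmooth Amacc Xconvex zerop OmegaP (6 * k + 5)
  h0 h1 Auv ub uK vK.
have NhE : N.+1%:R * h = s by rewrite /h mulrC divfK// pnatr_eq0.
have Nh'E : N.+1%:R * h' = s' by rewrite /h' mulrC divfK// pnatr_eq0.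
have := qP m (le_trans chi_s' ms'); have := qP N.+1; rewrite NhE => /(_ chi_s).
rewrite i6.
have : `|iter m (resolvent h A) u - iter N.+1 (resolvent h' A) u| <= e / 3.
  apply: (kobayashi_dist Xsmooth Amacc h0 h'0 (ltW e30) Auv).
  apply: le_trans cN; rewrite /c -mulrA ler_wpM2l ?exprn_ge0//.
  have -> : N.+1%:R * h' ^+ 2 = s' * h' by rewrite expr2 mulrA Nh'E.
  rewrite Nh'E.
  have -> : (s + (s' + 1) * s + s' ^+ 2) / N.+1%:R = h + (s' + 1) * h + s' * h'.
    by rewrite /h /h' expr2 !mulrDl !mulrA.
  rewrite lerD2r lerD//.
    rewrite expr2 (le_trans (ler_pM _ _ (_ : _ <= 1) (_ : _ <= h))) ?mul1r//; lra.
  by rewrite expr2 mulrA ler_wpM2r ?(ltW h0)//; lra.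
have := iter_resolvent_nonexpansive Xsmooth Amacc N.+1 x u h'0.
have := iter_resolvent_nonexpansive Xsmooth Amacc N.+1 x u h0.
set Sx := semigroup A s x; set Sx' := semigroup A s' x.
set a := iter N.+1 (resolvent h A) x; set a' := iter N.+1 (resolvent h' A) x.
set w := iter N.+1 _ u; set w' := iter N.+1 _ u; set wm := iter m _ u.
have {}H1 : `|Sx - a| < e / 3 := H1; have {}H2 : `|Sx' - a'| < e / 3 := H2.
move=> H3 H4 H5 H6 H7.
rewrite -/i.
(* The summands follow the chain [Sx], [a], [w], [q], [wm], [w'], [a'], [Sx']; the indices [3k + 2]
   and [6k + 5] supply [i / 3] and [i / 6]. *)
rewrite (_ : i + e =
  e / 3 + (i / 3 + (i / 6 + (i / 6 + (e / 3 + (i / 3 + e / 3)))))).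
  apply: le_trans (ler_distD a _ _) (lerD (ltW H1) _).
  apply: le_trans (ler_distD w _ _) (lerD (le_trans H3 ux3) _).
  apply: le_trans (ler_distD q _ _) (lerD H6 _).
  apply: le_trans (ler_distD wm _ _) (lerD _ _); first by rewrite distrC.
  apply: le_trans (ler_distD w' _ _) (lerD H5 _).
  apply: le_trans (ler_distD a' _ _) (lerD _ _); last by rewrite distrC ltW.
  by rewrite distrC (le_trans H4).
by field.
Qed.
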